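(* Let $\mathbb{K}$ be a field. The graded vector space $\mathbb{K}[\mathcal{MT}(St)]=\bigoplus_{n\ge1}\mathbb{K}[\mathcal{MT}(St_n)]$ spanned by the maximal tubings of the star graphs $St_n$, equipped with the product $*$, is an associative algebra (without unit requirement).
   Context: The star graph $St_n$ ($n\ge1$) has nodes $0,1,\dots,n$ and edges $\{0,i\}$, $1\le i\le n$. A tube is a nonempty set of nodes inducing a connected subgraph; two tubes are compatible if one contains the other or if they are disjoint and their union is not a tube; a tubing is a set of pairwise compatible tubes (here the universal tube of all nodes is left implicit). $\mathcal{MT}(St_n)$ is the set of maximal tubings of $St_n$. Each maximal tubing $T\neq\{\{1\},\dots,\{n\}\}$ is uniquely of the form $$T=\mathrm{Tub}_r(u_1,\dots,u_n):=\{\{u_1\},\dots,\{u_r\},t_0,t_0\cup\{u_{r+1}\},\dots,t_0\cup\{u_{r+1},\dots,u_{n-1}\}\},\quad t_0=\{0,u_1,\dots,u_r\},$$ where $0\le r<n$, $1\le u_1<\dots<u_r\le n$, and $(u_{r+1},\dots,u_n)$ is an arbitrary ordering of $\{1,\dots,n\}\setminus\{u_1,\dots,u_r\}$. The tubing $\{\{1\},\dots,\{n\}\}$ is denoted $\mathrm{Tub}_n=\mathrm{Tub}_n(1,\dots,n)$. $\mathrm{Sh}(a,b)$ is the set of permutations $\sigma$ of $\{1,\dots,a+b\}$ with $\sigma(1)<\dots<\sigma(a)$ and $\sigma(a+1)<\dots<\sigma(a+b)$ (only the identity if $a=0$ or $b=0$). For $T=\mathrm{Tub}_r(u_1,\dots,u_n)\in\mathcal{MT}(St_n)$,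 $V=\mathrm{Tub}_s(v_1,\dots,v_m)\in\mathcal{MT}(St_m)$ and $\sigma\in\mathrm{Sh}(n-r,m-s)$, set $$T*_\sigma V=\mathrm{Tub}_{r+s}(u_1,\dots,u_r,v_1+n,\dots,v_s+n,w_{\sigma^{-1}(1)},\dots,w_{\sigma^{-1}(n+m-r-s)}),$$ where $w_i=u_{r+i}$ for $1\le i\le n-r$ and $w_i=v_{s+i+r-n}+n$ for $n-r<i\le n+m-r-s$. The product is the bilinear extension of $$T*V=\sum_{\sigma\in\mathrm{Sh}(n-r,m-s)}T*_\sigma V ,$$ which in the degenerate cases reads: $\mathrm{Tub}_n*\mathrm{Tub}_m=\mathrm{Tub}_{n+m}$; $\mathrm{Tub}_n*V=\mathrm{Tub}_{n+s}(1,\dots,n,v_1+n,\dots,v_m+n)$; $T*\mathrm{Tub}_m=\mathrm{Tub}_{r+m}(u_1,\dots,u_r,n+1,\dots,n+m,u_{r+1},\dots,u_n)$. *)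

(* Defs.v *)
From HB Require Import structures.
From mathcomp Require Import all_boot all_order all_algebra all_fingroup.
From mathcomp Require Import sesquilinear finmap.
From mathcomp.multinomials Require Import monalg.
From mathcomp Require Import zify.

Set Implicit Arguments.
Unset Strict Implicit.
Unset Printing Implicit Defensive.

Import GRing.Theory.

Section Tubings.
Variables (V : finType) (edge : rel V).

Definition induced (t : {set V}) : rel V :=
  [rel x y | [&& x \in t, y \in t & edge x y]].

Definition tube (t : {set V}) : bool :=
  (t != set0) && [forall x in t, forall y in t, connect (induced t) x y].

Definition compatible (s t : {set V}) : bool :=
  [|| s \subset t, t \subset s | [disjoint s & t] && ~~ tube (s :|: t)].

(* The universal tube [setT] belongs implicitly to every tubing and is not
   recorded in it; it still counts as a tube in [compatible]. *)
Definition tubing (T : {set {set V}}) : bool :=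
  [forall t in T, tube t && (t != setT)] &&
  [forall s in T, forall t in T, compatible s t].

End Tubings.

Definition star_edge (n : nat) : rel 'I_n.+1 :=
  [rel i j | (i == ord0) && (j != ord0) || (j == ord0) && (i != ord0)].

Arguments star_edge : clear implicits.

Definition star_maximal (n : nat) (T : {set {set 'I_n.+1}}) : bool :=
  maxset (tubing (star_edge n)) T.

Definition MT (n : nat) : Type :=
  {T : {set {set 'I_n.+1}} | star_maximal T}.
HB.instance Definition _ n := Finite.on (MT n).

(* Tubings are described by words [u : seq nat] listing the leaves 1, ..., n. *)
Definition nodes (n : nat) (s : seq nat) : {set 'I_n.+1} :=
  [set i : 'I_n.+1 | val i \in s].

(* [Tub n r [:: u_1; ...; u_n]]: the singletons {u_1}, ..., {u_r} and the sets
   {0, u_1, ..., u_k} for r <= k < n. For r = n only the singletons remain, so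
   that Tub_n(1, ..., n) needs no separate clause. *)
Definition Tub (n r : nat) (u : seq nat) : {set {set 'I_n.+1}} :=
  [set:: [seq nodes n [:: x] | x <- take r u] ++
         [seq nodes n (0 :: take k u) | k <- iota r (n - r)]].

Definition is_code (n r : nat) (u : seq nat) : bool :=
  [&& r <= n, perm_eq u (iota 1 n) & sorted ltn (take r u)].

Section StarTubings.
Variable n : nat.
Implicit Types (s t : {set 'I_n.+1}) (T : {set {set 'I_n.+1}}).

Lemma star_tubeP t :
  reflect (ord0 \in t \/ exists2 i, i != ord0 & t = [set i])
          (tube (star_edge n) t).
Proof.
apply: (iffP idP) => [/andP[/set0Pn[x xt] /forall_inP conn]|].
  case t0: (ord0 \in t); [by left | right].
  have x0 : x != ord0 by apply: contraFneq t0 => <-.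
  exists x => //; apply/setP=> y; rewrite inE; apply/idP/eqP => [yt|->//].
  have /forall_inP /(_ _ yt) /connectP[[|z p] //= /andP[+ _] _] := conn _ xt.
  case/and3P=> _ zt /orP[] /andP[].
    by rewrite (negPf x0).
  by move=> /eqP z0; rewrite z0 t0 in zt.
case=> [t0|[i i0 ->]].
  have e0 x : x \in t -> connect (induced (star_edge n) t) x ord0.
    move=> xt; have [->|x0] := eqVneq x ord0; first exact: connect0.
    by apply: connect1; rewrite /induced /star_edge /= xt t0 ?eqxx x0 orbT.
  have e1 x : x \in t -> connect (induced (star_edge n) t) ord0 x.
    move=> xt; have [->|x0] := eqVneq x ord0; first exact: connect0.
    by apply: connect1; rewrite /induced /star_edge /= xt t0 ?eqxx x0.
  apply/andP; split; first by apply/set0Pn; exists ord0.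
  apply/forall_inP=> x xt; apply/forall_inP=> y yt.
  exact: connect_trans (e0 _ xt) (e1 _ yt).
apply/andP; split; first by apply/set0Pn; exists i; rewrite inE.
apply/forall_inP=> x; rewrite inE => /eqP->.
by apply/forall_inP=> y; rewrite inE => /eqP->; exact: connect0.
Qed.

Lemma tubingP T :
  reflect [/\ forall t, t \in T -> tube (star_edge n) t,
              forall t, t \in T -> t != setT
            & forall s t, s \in T -> t \in T -> compatible (star_edge n) s t]
          (tubing (star_edge n) T).
Proof.
apply: (iffP andP) => [[/forall_inP h1 /forall_inP h2]|[h1 h2 h3]].
  split=> [t /h1/andP[]|t /h1/andP[]|s t sT tT] //.
  by have /forall_inP := h2 _ sT; apply.
split; first by apply/forall_inP=> t tT; rewrite h1 ?h2.
by apply/forall_inP=> s sT; apply/forall_inP=> t tT; apply: h3.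
Qed.

Lemma compat_hub s t : ord0 \in s -> ord0 \in t ->
  compatible (star_edge n) s t = (s \subset t) || (t \subset s).
Proof.
move=> s0 t0; rewrite /compatible; have -> : [disjoint s & t] = false.
  by apply/negbTE/pred0Pn; exists ord0; rewrite /= s0 t0.
by rewrite orbF.
Qed.

Lemma compat_leaf (i : 'I_n.+1) t : i != ord0 -> ord0 \in t ->
  compatible (star_edge n) [set i] t -> i \in t.
Proof.
move=> i0 t0; rewrite /compatible sub1set => /or3P[//|/subsetP/(_ _ t0)|].
  by rewrite inE eq_sym (negPf i0).
by case/andP=> _ /star_tubeP[]; left; rewrite inE t0 orbT.
Qed.

Lemma compat_leaves (i j : 'I_n.+1) : i != ord0 -> j != ord0 ->
  compatible (star_edge n) [set i] [set j].
Proof.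
move=> i0 j0; rewrite /compatible; have [->|ij] := eqVneq i j.
  by rewrite subxx.
apply/or3P/Or33; rewrite disjoints1 inE ij /=.
apply/star_tubeP => -[|[k _ /setP e]].
  by rewrite !inE ![ord0 == _]eq_sym (negPf i0) (negPf j0).
have := e i; have := e j; rewrite !inE !eqxx orbT /= => /esym/eqP jk /esym/eqP ik.
by rewrite ik jk eqxx in ij.
Qed.

Lemma compatC s t :
  compatible (star_edge n) s t = compatible (star_edge n) t s.
Proof. by rewrite /compatible orbCA disjoint_sym setUC. Qed.

Section Code.
Variables (r : nat) (u : seq nat).
Hypothesis code : is_code n r u.

Let rn : r <= n. Proof. by case/and3P: code. Qed.
Let uP : perm_eq u (iota 1 n). Proof. by case/and3P: code. Qed.

Lemma code_size : size u = n.
Proof. by rewrite (perm_size uP) size_iota. Qed.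

Lemma code_take : take n u = u.
Proof. by rewrite take_oversize ?code_size. Qed.

Lemma code_uniq : uniq u.
Proof. by rewrite (perm_uniq uP) iota_uniq. Qed.

Lemma code_mem x : (x \in u) = (0 < x <= n).
Proof. by rewrite (perm_mem uP) mem_iota; lia. Qed.

Lemma nodes1 (i : 'I_n.+1) : nodes n [:: val i] = [set i].
Proof. by apply/setP=> j; rewrite !inE. Qed.

Lemma mem_nodes0 (s : seq nat) : ord0 \in nodes n (0 :: s).
Proof. by rewrite !inE. Qed.

Lemma TubP t : reflect
  ((exists i : 'I_n.+1, [/\ i != ord0, val i \in take r u & t = [set i]]) \/
   (exists2 k, r <= k < n & t = nodes n (0 :: take k u)))
  (t \in Tub n r u).
Proof.
rewrite inE mem_cat.
apply: (iffP orP) => -[].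
- case/mapP=> x xu ->; left.
  have : x \in u by apply: mem_take xu.
  rewrite code_mem => /andP[x0 xn].
  have xlt : x < n.+1 by [].
  exists (Ordinal xlt); split=> //; first by apply/eqP=> -[] E; rewrite E in x0.
  by rewrite -nodes1.
- case/mapP=> k; rewrite mem_iota => kr ->; right; exists k => //; lia.
- case=> i [i0 iu ->]; left; apply/mapP; exists (val i) => //.
  by rewrite nodes1.
- case=> k kr ->; right; apply/mapP; exists k => //.
  by rewrite mem_iota; lia.
Qed.

Lemma nodesS k l : k <= l -> nodes n (0 :: take k u) \subset nodes n (0 :: take l u).
Proof.
move=> kl; apply/subsetP=> x; rewrite !inE => /orP[->//|].
by rewrite -(take_takel u kl) => /mem_take ->; rewrite orbT.
Qed.

Lemma nodes_full : nodes n (0 :: take n u) = setT.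
Proof.
apply/setP=> x; rewrite !inE code_take code_mem.
by have := ltn_ord x; rewrite /=; lia.
Qed.

Lemma card_nodes k : k <= n -> #|nodes n (0 :: take k u)| = k.+1.
Proof.
move=> kn.
have su : uniq (0 :: take k u).
  rewrite /= take_uniq ?code_uniq // andbT.
  by apply/negP=> /mem_take; rewrite code_mem.
rewrite cardE -(size_map val).
rewrite (@perm_size _ _ (0 :: take k u)) /=; first by rewrite size_takel ?code_size.
apply: uniq_perm => //; first by rewrite map_inj_uniq ?enum_uniq //; exact: val_inj.
move=> x; apply/mapP/idP => [[y]|xs].
  by rewrite mem_enum inE => ys ->.
have xn : x < n.+1.
  by move: xs; rewrite inE => /orP[/eqP->//|/mem_take]; rewrite code_mem; lia.
by exists (Ordinal xn) => //; rewrite mem_enum inE.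
Qed.

Lemma Tub_tubing : tubing (star_edge n) (Tub n r u).
Proof.
apply/tubingP; split.
- move=> t /TubP[[i [i0 _ ->]]|[k _ ->]]; apply/star_tubeP; last by left; rewrite mem_nodes0.
  by right; exists i.
- move=> t /TubP[[i [i0 _ ->]]|[k kr ->]]; apply/eqP=> /setP.
    by move/(_ ord0); rewrite !inE eq_sym (negPf i0).
  move/setP/(congr1 (fun A : {set _} => #|A|)).
  by rewrite card_nodes ?cardsT ?card_ord; lia.
have sing i k : val i \in take r u -> r <= k ->
    compatible (star_edge n) [set i] (nodes n (0 :: take k u)).
  move=> iu rk; rewrite /compatible sub1set inE in_cons.
  by rewrite -(take_takel u rk) in iu; rewrite (mem_take iu) orbT.
move=> s t /TubP[[i [i0 iu ->]]|[k /andP[rk kn] ->]].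
- move=> /TubP[[j [j0 _ ->]]|[k /andP[rk kn] ->]]; first exact: compat_leaves.
  exact: sing.
- move=> /TubP[[j [j0 ju ->]]|[l /andP[rl ln] ->]].
    by rewrite compatC sing.
  rewrite compat_hub ?mem_nodes0 //.
  by case/orP: (leq_total k l) => kl; rewrite (nodesS kl) ?orbT.
Qed.

Lemma Tub_maximal : star_maximal (Tub n r u).
Proof.
apply/maxsetP; split; first exact: Tub_tubing.
move=> T /tubingP[Tt TT Tc] sub; apply/eqP; rewrite eqEsubset sub andbT.
have sT := subsetP sub.
have hub k : r <= k < n -> nodes n (0 :: take k u) \in T.
  by move=> kr; apply: sT; apply/TubP; right; exists k.
apply/subsetP=> t tT; apply/TubP; case/star_tubeP: (Tt _ tT) => [t0|[i i0 ti]].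
  right.
  have rt : nodes n (0 :: take r u) \subset t.
    apply/subsetP=> x; rewrite inE in_cons => /orP[/eqP x0|xu].
      by have -> : x = ord0 by apply: val_inj.
    have x0 : x != ord0.
      by apply: contraTneq xu => ->; apply/negP=> /mem_take; rewrite code_mem.
    apply: compat_leaf (x0) (t0) (Tc _ _ _ tT); apply: sT.
    by apply/TubP; left; exists x.
  have ex : exists k, (r <= k <= n) && (nodes n (0 :: take k u) \subset t).
    by exists r; rewrite leqnn rn.
  have bd k : (r <= k <= n) && (nodes n (0 :: take k u) \subset t) -> k <= n by lia.
  case: (ex_maxnP ex bd) => k /andP[/andP[rk kn] kt] kmax.
  have kn' : k < n.
    rewrite ltn_neqAle kn andbT; apply: contraTneq kt => ->.
    by rewrite nodes_full subTset TT.
  exists k; first by rewrite rk kn'.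
  have nkt : ~~ (nodes n (0 :: take k.+1 u) \subset t).
    apply/negP=> kt'; have := kmax k.+1; rewrite kt' andbT ltnn.
    by move=> H; have : false by apply: H; lia.
  have tk : t \subset nodes n (0 :: take k.+1 u).
    have [E|kn''] := eqVneq k.+1 n; first by rewrite E nodes_full subsetT.
    have kT : nodes n (0 :: take k.+1 u) \in T by apply: hub; lia.
    by have := Tc _ _ tT kT; rewrite compat_hub ?mem_nodes0 // (negPf nkt) orbF.
  apply/eqP; rewrite eq_sym eqEcard kt /=.
  rewrite card_nodes // -ltnS -(card_nodes kn').
  apply: proper_card; rewrite properE tk; exact: nkt.
left; exists i; split=> //; have [E|rn'] := eqVneq r n.
  by rewrite E code_take code_mem lt0n i0 -ltnS ltn_ord.
have rT : nodes n (0 :: take r u) \in T by apply: hub; lia.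
have := compat_leaf i0 (mem_nodes0 (take r u)).
rewrite -ti inE in_cons => /(_ (Tc _ _ tT rT)).
by case/orP=> // /eqP E; case/eqP: i0; apply: val_inj.
Qed.

End Code.

Lemma Tub_inj r r' u u' : is_code n r u -> is_code n r' u' ->
  Tub n r u = Tub n r' u' -> r = r' /\ u = u'.
Proof.
move=> cu cu' E.
have sub q v q' v' : is_code n q v -> is_code n q' v' -> Tub n q v = Tub n q' v' ->
    {subset take q v <= take q' v'}.
  move=> cv cv' Ev x xv; have := code_mem cv x; rewrite (mem_take xv) => /esym/andP[x0 xn].
  have xn1 : x < n.+1 by [].
  have x1 : Ordinal xn1 != ord0 by apply/eqP=> -[] e; rewrite e in x0.
  have : [set Ordinal xn1] \in Tub n q' v'.
    by rewrite -Ev; apply/(TubP cv); left; exists (Ordinal xn1).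
  case/(TubP cv') => [[i [_ iv /set1_inj e]]|[k _ /setP/(_ ord0)]].
    by rewrite -e in iv.
  by rewrite !inE eq_sym (negPf x1).
have tE : take r u = take r' u'.
  apply: (@irr_sorted_eq _ ltn ltn_trans ltnn).
  - by case/and3P: cu.
  - by case/and3P: cu'.
  by move=> x; apply/idP/idP; apply: sub.
have rE : r = r'.
  move/(congr1 size): tE; rewrite !size_takel ?(code_size cu) ?(code_size cu') //.
    by case/and3P: cu'.
  by case/and3P: cu.
subst r'; split=> //.
have rn : r <= n by case/and3P: cu.
have tk k : r <= k -> k <= n -> take k u =i take k u'.
  move=> rk; rewrite leq_eqVlt => /orP[/eqP->|kn].
    by move=> x; rewrite (code_take cu) (code_take cu') (code_mem cu) (code_mem cu').
  have : nodes n (0 :: take k u) \in Tub n r u'.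
    by rewrite -E; apply/(TubP cu); right; exists k; rewrite ?rk.
  case/(TubP cu') => [[i [i0 _ /setP/(_ ord0)]]|[l rl e]].
    by rewrite !inE eqxx /= [_ == i]eq_sym (negPf i0).
  have kl : k = l.
    move/(congr1 (fun A : {set _} => #|A|)): (e).
    by rewrite (card_nodes cu) ?(card_nodes cu') //; lia.
  rewrite -{}kl {rl l} in e; move=> x.
  have [xn|xn] := ltnP x n.+1; last first.
    apply/idP/idP => /mem_take; first by rewrite (code_mem cu); lia.
    by rewrite (code_mem cu'); lia.
  have [->|x0] := posnP x.
    by apply/idP/idP => /mem_take; rewrite ?(code_mem cu) ?(code_mem cu').
  by have /setP/(_ (Ordinal xn)) := e; rewrite !inE /= eqn0Ngt x0.
have tke d : d <= n - r -> take (r + d) u = take (r + d) u'.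
  elim: d => [|d IHd] dn; first by rewrite addn0.
  have su : r + d < size u by rewrite (code_size cu); lia.
  have su' : r + d < size u' by rewrite (code_size cu'); lia.
  have IH : take (r + d) u = take (r + d) u' by apply: IHd; lia.
  rewrite addnS (take_nth 0 su) (take_nth 0 su') IH; congr rcons.
  have H : take (r + d).+1 u =i take (r + d).+1 u' by apply: tk; lia.
  have := H (nth 0 u (r + d)).
  rewrite (take_nth 0 su) (take_nth 0 su') !mem_rcons !inE eqxx /= -IH => /esym.
  case/orP=> [/eqP//|]; have := take_uniq (r + d).+1 (code_uniq cu).
  by rewrite (take_nth 0 su) rcons_uniq => /andP[/negPf->].
have := tke (n - r) (leqnn _); rewrite subnKC //.
by rewrite (code_take cu) (code_take cu').
Qed.

Lemma downset_take (T : eqType) (leT : rel T) (p : pred T) (s : seq T) :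
  transitive leT -> sorted leT s ->
  {in s &, forall x y, leT x y -> p y -> p x} ->
  filter p s = take (count p s) s.
Proof.
move=> tr; elim: s => //= x s IH ps dn.
have ds : {in s &, forall x y, leT x y -> p y -> p x}.
  by move=> a b sa sb; apply: dn; rewrite inE ?sa ?sb orbT.
case px : (p x); first by rewrite add1n /= IH // (path_sorted ps).
suff c0 : has p s = false.
  have := c0; rewrite has_count lt0n => /negbFE/eqP->; rewrite /=.
  by apply/eqP; rewrite -(negbK (_ == _)) -has_filter c0.
apply/negP=> /hasP[y ys py].
have /allP/(_ y ys) xy := order_path_min tr ps.
have := dn x y; rewrite inE eqxx => /(_ isT); rewrite inE ys orbT => /(_ isT xy py).
by rewrite px.
Qed.

(* The leaves are sorted by the number of tubes around the hub avoiding them. *)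
Lemma tubing_sub_Tub T : tubing (star_edge n) T ->
  exists r u, is_code n r u /\ T \subset Tub n r u.
Proof.
case/tubingP=> Tt TT Tc.
pose C := [set t in T | ord0 \in t].
have CT t : t \in C -> t \in T /\ ord0 \in t by rewrite inE => /andP.
pose key x := #|[set t in C | inord x \notin t]|.
pose le := [rel x y : nat | key x <= key y].
have le_tot : total le by move=> x y; exact: leq_total.
have le_tr : transitive le by move=> y x z; exact: leq_trans.
pose u := sort le (iota 1 n).
pose r := count (fun x => key x == 0) u.
have uP : perm_eq u (iota 1 n) by rewrite /u perm_sort.
have us : sorted le u by exact: sort_sorted.
have su : size u = n by rewrite (perm_size uP) size_iota.
have mu x : (x \in u) = (0 < x <= n) by rewrite (perm_mem uP) mem_iota; lia.
have rE : take r u = filter (fun x => key x == 0) u.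
  rewrite (downset_take le_tr us) // => x y _ _ /= + /eqP y0.
  by rewrite y0 leqn0.
have key0 x : (key x == 0) = [forall t in C, inord x \in t].
  rewrite cards_eq0; apply/eqP/forall_inP => [/setP e t tC|h].
    by have := e t; rewrite inE in_set0 tC /= => /negbFE.
  by apply/setP=> t; rewrite inE in_set0; apply/negP=> /andP[/h->].
have dn t : t \in C -> {in u &, forall x y, le x y -> inord y \in t -> (inord x : 'I_n.+1) \in t}.
  move=> tC x y _ _ xy yt; apply/negPn/negP=> xt.
  suff : key y < key x by rewrite ltnNge (xy : key x <= key y).
  apply: proper_card; apply/properP; split; last first.
    by exists t; rewrite inE tC // yt.
  apply/subsetP=> s; rewrite !inE -andbA => /and3P[sT s0 ys].
  rewrite sT s0 /=; apply: contra ys => xs.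
  have [tT t0] := CT _ tC; have := Tc _ _ tT sT; rewrite compat_hub //.
  case/orP=> /subsetP; first by apply.
  by move/(_ _ xs); rewrite (negPf xt).
have code : is_code n r u.
  rewrite /is_code uP rE -{1}su count_size /=.
  rewrite /u (filter_sort le_tot le_tr).
  set f := filter _ _; have -> : sort le f = f.
    apply: sorted_sort => //; rewrite sorted_pairwise //.
    apply/(pairwiseP 0) => i j ilt jlt _ /=.
    have : nth 0 f i \in f by rewrite mem_nth.
    by rewrite mem_filter => /andP[/eqP-> _].
  exact/sorted_filter/iota_ltn_sorted/ltn_trans.
exists r, u; split=> //; apply/subsetP=> t tT; apply/(TubP code).
case/star_tubeP: (Tt _ tT) => [t0|[i i0 ti]]; [right | left].
  have tC : t \in C by rewrite inE tT.
  pose p x := (inord x : 'I_n.+1) \in t.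
  have pE : filter p u = take (count p u) u := downset_take le_tr us (dn _ tC).
  have tE : t = nodes n (0 :: take (count p u) u).
    apply/setP=> x; rewrite inE in_cons -pE mem_filter mu /p inord_val.
    have [->|x0] := eqVneq x ord0; first by rewrite t0.
    have -> : (val x == 0) = false by apply/negbTE; apply: contra x0 => /eqP e; apply/eqP/val_inj.
    by rewrite lt0n x0 -ltnS ltn_ord !andbT.
  exists (count p u) => //; apply/andP; split.
    by apply: sub_count => x /=; rewrite key0 => /forall_inP h; apply: h.
  rewrite ltn_neqAle -{2}su count_size andbT.
  apply/eqP=> cn; have := TT _ tT; rewrite tE cn.
  by rewrite (nodes_full code) eqxx.
exists i; split=> //; rewrite rE mem_filter mu lt0n i0 -ltnS ltn_ord !andbT key0.
apply/forall_inP=> s sC; have [sT s0] := CT _ sC.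
rewrite inord_val; apply: (compat_leaf i0 s0).
by rewrite -ti; apply: Tc.
Qed.

Lemma MT_code T : star_maximal T ->
  exists c : nat * seq nat, is_code n c.1 c.2 && (Tub n c.1 c.2 == T).
Proof.
case/maxsetP=> Ttub Tmax; have [r [u [cu sub]]] := tubing_sub_Tub Ttub.
by exists (r, u); rewrite cu /= (Tmax _ (Tub_tubing cu) sub) eqxx.
Qed.

End StarTubings.

Section Coordinates.
Variables (n : nat) (T : MT n).

Definition code : nat * seq nat := xchoose (MT_code (valP T)).
Definition rk : nat := code.1.
Definition word : seq nat := code.2.

Lemma codeP : is_code n rk word.
Proof. by case/andP: (xchooseP (MT_code (valP T))). Qed.

Lemma codeK : Tub n rk word = val T.
Proof. by case/andP: (xchooseP (MT_code (valP T))) => _ /eqP. Qed.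

Lemma code_unique r u :
  is_code n r u -> Tub n r u = val T -> r = rk /\ u = word.
Proof. by move=> cu E; apply: (Tub_inj cu codeP); rewrite codeK. Qed.

End Coordinates.

Definition Sh (a b : nat) : {set 'S_(a + b)} :=
  [set sigma : 'S_(a + b) | [forall i : 'I_(a + b), forall j : 'I_(a + b),
     (i < j) && ((j < a) || (a <= i)) ==> (sigma i < sigma j)]].

Section StarProduct.
Variables n m : nat.
Implicit Types (T : MT n) (V : MT m).

(* Positions in words and in permutations are counted from 0, so that
   [nth 0 w i] is the letter w_(i+1); the letters themselves are 1, ..., n. *)
Definition shuffle_word T V (sigma : 'S_(n - rk T + (m - rk V))) : seq nat :=
  let w := drop (rk T) (word T) ++ [seq v + n | v <- drop (rk V) (word V)] in
  take (rk T) (word T) ++ [seq v + n | v <- take (rk V) (word V)] ++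
    [seq nth 0 w (sigma^-1 i)%g | i <- enum 'I_(n - rk T + (m - rk V))].

Lemma shuffle_code T V sigma :
  is_code (n + m) (rk T + rk V) (@shuffle_word T V sigma).
Proof.
have cT := codeP T; have cV := codeP V.
have /and3P[rn uP us] := cT; have /and3P[sm vP vs] := cV.
have su := code_size cT; have sv := code_size cV.
apply/and3P; split; first exact: leq_add.
  rewrite /shuffle_word; set w := _ ++ [seq v + n | v <- drop _ _].
  have sw : size w = n - rk T + (m - rk V).
    by rewrite size_cat size_map !size_drop su sv.
  have wP : perm_eq [seq nth 0 w (sigma^-1 i)%g | i <- enum 'I_(n - rk T + (m - rk V))] w.
    rewrite (map_comp (fun i : 'I_(n - rk T + (m - rk V)) => nth 0 w i) (fun i => (sigma^-1 i)%g)).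
    apply: (@perm_trans _ [seq nth 0 w (i : 'I_(n - rk T + (m - rk V))) | i <- enum 'I_(n - rk T + (m - rk V))]).
      apply: perm_map; apply: uniq_perm.
      - by rewrite map_inj_uniq ?enum_uniq //; exact: perm_inj.
      - exact: enum_uniq.
      move=> i; rewrite mem_enum; apply/mapP; exists (sigma i); rewrite ?mem_enum //.
      by rewrite permK.
    rewrite (map_comp (nth 0 w) val) val_enum_ord -sw.
    by rewrite [X in perm_eq X]mkseq_nth.
  rewrite iotaD; apply: (@perm_trans _ (word T ++ [seq v + n | v <- word V])).
    rewrite -{2}(cat_take_drop (rk T) (word T)) -catA perm_cat2l.
    rewrite -{2}(cat_take_drop (rk V) (word V)) map_cat.
    apply: (@perm_trans _ ([seq v + n | v <- take (rk V) (word V)] ++ w)); first by rewrite perm_cat2l.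
    by rewrite /w perm_catCA.
  apply: perm_cat => //.
  have -> : iota (1 + n) m = [seq v + n | v <- iota 1 m].
    by rewrite addnC iotaDl; apply: eq_map => x; rewrite addnC.
  exact: perm_map.
rewrite /shuffle_word catA take_cat size_cat size_map !size_takel ?su ?sv // ltnn subnn take0 cats0.
rewrite (sorted_pairwise ltn_trans) pairwise_cat.
rewrite -!(sorted_pairwise ltn_trans) us /=; apply/andP; split.
  apply/allrelP=> x y /mem_take xT /mapP[v /mem_take vV ->].
  by move: xT vV; rewrite (code_mem cT) (code_mem cV); lia.
by rewrite sorted_map; apply: sub_sorted vs => x y /=; rewrite ltn_add2r.
Qed.

Definition shuffle_tubing T V (sigma : 'S_(n - rk T + (m - rk V))) : MT (n + m) :=
  exist _ (Tub (n + m) (rk T + rk V) (shuffle_word sigma))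
    (Tub_maximal (shuffle_code sigma)).

End StarProduct.

Local Open Scope ring_scope.

Section BilinearExtension.
Variables (K : fieldType) (B : choiceType) (b : B -> B -> {malg K[B]}).

Definition bilinear_extension (f g : {malg K[B]}) : {malg K[B]} :=
  \sum_(x <- msupp f) \sum_(y <- msupp g) (f@_x * g@_y) *: b x y.

Lemma bilinear_extensionU (x y : B) :
  bilinear_extension << x >> << y >> = b x y.
Proof.
rewrite /bilinear_extension msuppU oner_eq0 big_seq_fset1.
by rewrite msuppU oner_eq0 big_seq_fset1 !mcoeffUU mulr1 scale1r.
Qed.

End BilinearExtension.

(* The basis of the graded space: pairs of k and a maximal tubing of the star
   St_(k+1), which is the homogeneous part of degree k+1; degrees start at 1.
   The sum of the degrees k+1 and l+1 is, by computation, (k+l+1)+1. *)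
Definition StarBasis : choiceType := {k : nat & MT k.+1}.

Definition star_elt (k : nat) (T : MT k.+1) : StarBasis := existT _ k T.

Notation StarSpace K := {malg K[StarBasis]}.

Definition star_mul_basis (K : fieldType) (x y : StarBasis) : StarSpace K :=
  \sum_(sigma in Sh ((tag x).+1 - rk (tagged x)) ((tag y).+1 - rk (tagged y)))
    << star_elt (shuffle_tubing sigma : MT (tag x + (tag y).+1).+1) >>.

Definition star_mul (K : fieldType) : StarSpace K -> StarSpace K -> StarSpace K :=
  bilinear_extension (star_mul_basis K).

Lemma star_mulU (K : fieldType) (x y : StarBasis) :
  star_mul << x >> << y >> = star_mul_basis K x y.
Proof. exact: bilinear_extensionU. Qed.

(* Main.v *)
(* A maximal tubing z of St_N is a pair of words (u_1 ... u_r, u_(r+1) ... u_N).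
   Restricting both words to the letters d+1, ..., d+k and subtracting d gives
   a maximal tubing of St_k. In degrees n and m, the coefficient of z in x * y
   is 1 if z restricts to x on 1, ..., n and to y on n+1, ..., n+m, and 0
   otherwise: a shuffle of words with disjoint letters is determined by the two
   subwords it restricts to. Since a restriction of a restriction is a
   restriction, the coefficient of z in either bracketing of x * y * w is 1
   exactly when z restricts to x, y and w on three consecutive intervals. *)
From HB Require Import structures.
Require Import Defs.
From mathcomp Require Import all_boot all_order all_algebra all_fingroup.
From mathcomp Require Import sesquilinear finmap.
From mathcomp.multinomials Require Import monalg.
From mathcomp Require Import zify.

Set Implicit Arguments.
Unset Strict Implicit.
Unset Printing Implicit Defensive.

Import GRing.Theory.

(** * Shuffles of two words over disjoint alphabets *)

Section ShuffleWords.
Variables (T : eqType) (x0 : T) (P : pred T).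

(** The form of the last block of [shuffle_word]: [sigma] sends the position of a letter in [w] to
    its new position. *)
Definition perm_word (N : nat) (w : seq T) (sigma : 'S_N) : seq T :=
  [seq nth x0 w (sigma^-1 i)%g | i <- enum 'I_N].

Lemma nth_perm_word N (w : seq T) (sigma : 'S_N) (j : 'I_N) :
  nth x0 (perm_word w sigma) (sigma j) = nth x0 w j.
Proof.
rewrite /perm_word (nth_map (sigma j)) ?size_enum_ord ?ltn_ord //.
by rewrite nth_ord_enum permK.
Qed.

(** Since the letters of [w] are distinct, the letter found at position [i] reveals the preimage of
    [i] under the permutation. *)
Lemma perm_word_inj N (w : seq T) : size w = N -> uniq w ->
  injective (@perm_word N w).
Proof.
move=> sw uw s1 s2 e; apply: invg_inj; apply/permP=> i; apply: val_inj.
have nthV s : nth x0 (perm_word w s) i = nth x0 w (s^-1 i)%g.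
  by rewrite -{1}(permKV s i) nth_perm_word.
move/(congr1 (fun s => nth x0 s i)): e; rewrite !nthV => /eqP.
by rewrite nth_uniq ?sw ?ltn_ord // => /eqP.
Qed.

(** Both lists are strictly increasing and have the same elements, because the inverse of [sigma] is
    increasing on the image of [A]. *)
Lemma increasing_enum N (A : {pred 'I_N}) (sigma : 'S_N) :
  {in A &, forall i j : 'I_N, i < j -> sigma i < sigma j} ->
  [seq (sigma^-1 i)%g | i <- enum 'I_N & (sigma^-1 i)%g \in A] = enum A.
Proof.
move=> incr.
have st (B : {pred 'I_N}) : sorted (fun i j : 'I_N => i < j) (enum B).
  rewrite /enum_mem; apply: sorted_filter; first by move=> ? ? ?; exact: ltn_trans.
  by rewrite -enumT; have := iota_ltn_sorted 0 N; rewrite -val_enum_ord sorted_map.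
apply: (@irr_sorted_eq _ (fun i j : 'I_N => i < j)).
- by move=> ? ? ?; exact: ltn_trans.
- by move=> ?; exact: ltnn.
- rewrite sorted_map.
  set s := filter _ _.
  have ss : sorted (fun i j : 'I_N => i < j) s.
    by apply: sorted_filter (st _) => ? ? ?; exact: ltn_trans.
  have sA : all (fun i => (sigma^-1 i)%g \in A) s by exact: filter_all.
  apply: (sub_in_sorted _ sA ss) => i j iA jA ij /=.
  rewrite ltnNge leq_eqVlt; apply/negP=> /orP[/eqP/val_inj/perm_inj e|].
    by rewrite e ltnn in ij.
  by move/(incr _ _ jA iA); rewrite !permKV; lia.
- exact: st.
move=> i; rewrite mem_enum; apply/mapP/idP => [[j]|iA].
  by rewrite mem_filter => /andP[jA _] ->.
by exists (sigma i); rewrite ?permK // mem_filter permK iA mem_enum.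
Qed.

Variables (p q : nat) (s1 s2 : seq T).
Hypotheses (sz1 : size s1 = p) (sz2 : size s2 = q).
Hypotheses (P1 : all P s1) (P2 : all (predC P) s2).
Let w := s1 ++ s2.

Let sw : size w = p + q. Proof. by rewrite size_cat sz1 sz2. Qed.

Let nthP (j : 'I_(p + q)) : P (nth x0 w j) = (j < p).
Proof.
rewrite nth_cat sz1; case: ltnP => jp; first by rewrite (allP P1) // mem_nth ?sz1.
apply/negbTE/(allP P2)/mem_nth; rewrite sz2; have := ltn_ord j; lia.
Qed.

Lemma val_enum_filter N (f : pred nat) :
  [seq val i | i <- enum [pred i : 'I_N | f i]] = filter f (iota 0 N).
Proof.
by rewrite -val_enum_ord filter_map /= enumT /enum_mem.
Qed.

Lemma filter_perm_word (f : pred nat) (R : pred T) (sigma : 'S_(p + q)) :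
  {in [pred i : 'I_(p + q) | f i] &,
    forall i j : 'I_(p + q), i < j -> sigma i < sigma j} ->
  (forall i : 'I_(p + q), R (nth x0 w i) = f i) ->
  filter R (perm_word w sigma) = [seq nth x0 w i | i <- iota 0 (p + q) & f i].
Proof.
move=> incr Rf; rewrite /perm_word filter_map.
rewrite (eq_filter
  (a2 := fun i => (sigma^-1 i)%g \in [pred i : 'I_(p + q) | f i])).
  by rewrite -val_enum_filter -(increasing_enum incr) -!map_comp.
by move=> i; rewrite /= Rf.
Qed.

(** The letters of [w] in [P] fill exactly the positions below [p]. On these positions, and on the
    remaining ones, a shuffle is increasing, so each filter reads its letters in their original
    order. *)
Lemma shuffle_filter (sigma : 'S_(p + q)) : sigma \in Sh p q ->
  filter P (perm_word w sigma) = s1 /\ filter (predC P) (perm_word w sigma) = s2.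
Proof.
rewrite inE => /forallP sh; split.
  rewrite (@filter_perm_word (fun i => i < p)) //.
    rewrite iotaD filter_cat (eq_in_filter (a2 := predT)) ?filter_predT; last first.
      by move=> i; rewrite mem_iota.
    rewrite (eq_in_filter (a2 := pred0)) ?filter_pred0 ?cats0; last first.
      by move=> i; rewrite mem_iota /= => ?; apply/negbTE; lia.
    rewrite -[RHS](@mkseq_nth _ x0) sz1; apply/eq_in_map => i.
    by rewrite mem_iota nth_cat sz1 => /andP[_ ->].
  move=> i j; rewrite !inE => ip jp ij.
  by have /forallP/(_ j)/implyP := sh i; apply; rewrite ij jp.
rewrite (@filter_perm_word (fun i => ~~ (i < p))) //; last by move=> i; rewrite /= nthP.
  rewrite iotaD filter_cat (eq_in_filter (a2 := pred0)) ?filter_pred0; last first.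
    by move=> i; rewrite mem_iota => /andP[_ /= ->].
  rewrite (eq_in_filter (a2 := predT)) ?filter_predT; last first.
    by move=> i; rewrite mem_iota /= => ?; apply/negP; lia.
  (* The positions of the second block are written as [p + i] with [i < q]. *)
  rewrite -[RHS](@mkseq_nth _ x0) sz2 /mkseq add0n -[X in iota X]addn0 iotaDl -map_comp.
  apply/eq_in_map => i _ /=.
  by rewrite nth_cat sz1 ltnNge leq_addr addKn.
move=> i j; rewrite !inE => ip jp ij.
by have /forallP/(_ j)/implyP := sh i; apply; rewrite ij [p <= i]leqNgt ip orbT.
Qed.

(** A duplicate-free [c] is sorted for the comparison of indices in [c], and filtering preserves
    sortedness. *)
Lemma index_filter_mono (R : pred T) (c : seq T) i j : uniq c ->
  i < j < size (filter R c) ->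
  index (nth x0 (filter R c) i) c < index (nth x0 (filter R c) j) c.
Proof.
move=> uc /andP[ij jc].
have tr : transitive (fun x y => index x c < index y c).
  by move=> ? ? ?; exact: ltn_trans.
have st : sorted (fun x y => index x c < index y c) c.
  rewrite -[X in sorted _ X](mkseq_nth x0) /mkseq sorted_map.
  have al : all (fun i => i < size c) (iota 0 (size c)).
    by apply/allP=> k; rewrite mem_iota.
  apply: (sub_in_sorted _ al (iota_ltn_sorted _ _)) => k l kc lc kl /=.
  by rewrite !index_uniq.
by apply: (sorted_ltn_nth tr x0 (sorted_filter tr R st)); rewrite ?inE //; lia.
Qed.

(** The permutation sends the position of a letter in [w] to its index in [c]. It is a shuffle
    because [s1] and [s2] are subwords of [c]. *)
Lemma shuffle_surj (c : seq T) : uniq c ->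
  filter P c = s1 -> filter (predC P) c = s2 ->
  exists2 sigma, sigma \in Sh p q & perm_word w sigma = c.
Proof.
move=> uc c1 c2.
have cw : perm_eq c w by rewrite /w -c1 -c2 perm_sym perm_filterC.
have uw : uniq w by rewrite -(perm_uniq cw).
have sc : size c = p + q by rewrite (perm_size cw).
have ic (i : 'I_(p + q)) : index (nth x0 w i) c < p + q.
  by rewrite -[X in _ < X]sc index_mem (perm_mem cw) mem_nth ?sw.
pose f (i : 'I_(p + q)) := Ordinal (ic i).
have mem_w (i : 'I_(p + q)) : nth x0 w i \in c.
  by rewrite (perm_mem cw) mem_nth ?sw.
have f_inj : injective f.
  move=> i j /(congr1 val) /= e; apply/val_inj/eqP.
  rewrite -(nth_uniq x0 _ _ uw) ?sw ?ltn_ord //.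
  by rewrite -(nth_index x0 (mem_w i)) e nth_index.
exists (perm f_inj).
  rewrite inE; apply/forallP=> i; apply/forallP=> j; apply/implyP=> /andP[ij cs].
  rewrite !permE /=.
  have [jp|pj] := ltnP j p.
    rewrite !nth_cat sz1 jp (ltn_trans ij jp) -c1.
    by apply: index_filter_mono => //; rewrite ij c1 sz1.
  have pi : p <= i by case/orP: cs => //; lia.
  rewrite !nth_cat sz1 [i < p]ltnNge pi [j < p]ltnNge pj /= -c2.
  by apply: index_filter_mono => //; rewrite c2 sz2; have := ltn_ord j; lia.
apply: (@eq_from_nth _ x0); first by rewrite size_map size_enum_ord sc.
move=> k; rewrite size_map size_enum_ord => kpq.
pose j := ((perm f_inj)^-1 (Ordinal kpq))%g.
have -> : k = perm f_inj j by rewrite /j permKV.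
by rewrite nth_perm_word permE /= nth_index.
Qed.

End ShuffleWords.

(** * Restriction of words to an interval of letters *)

Section Restriction.
Implicit Types (d e n : nat) (s t : seq nat).

(** The truncated subtraction is exact here, since only letters above [d] are kept. *)
Definition restrict d n s : seq nat := [seq v - d | v <- s & d < v <= d + n].

Lemma restrict_cat d n s t :
  restrict d n (s ++ t) = restrict d n s ++ restrict d n t.
Proof. by rewrite /restrict filter_cat map_cat. Qed.

Lemma restrict_restrict e k d n s : e + k <= n ->
  restrict e k (restrict d n s) = restrict (d + e) k s.
Proof.
move=> ekn; rewrite /restrict filter_map -filter_predI -map_comp.
rewrite (eq_filter (a2 := fun v => d + e < v <= d + e + k)); last first.
  by move=> v /=; lia.
by apply: eq_map => v /=; lia.
Qed.

Lemma perm_restrict d n s t : perm_eq s t ->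
  perm_eq (restrict d n s) (restrict d n t).
Proof. by move=> st; apply/perm_map/perm_filter. Qed.

Lemma restrict_iota d n N : d + n <= N ->
  perm_eq (restrict d n (iota 1 N)) (iota 1 n).
Proof.
move=> dnN; apply: uniq_perm; last 1 first.
- move=> v; rewrite mem_iota; apply/mapP/idP => [[u]|vn].
    by rewrite mem_filter => /andP[? _] ->; lia.
  by exists (v + d); [rewrite mem_filter mem_iota; lia | lia].
- rewrite map_inj_in_uniq ?filter_uniq ?iota_uniq // => u v.
  by rewrite !mem_filter => /andP[? _] /andP[? _]; lia.
- exact: iota_uniq.
Qed.

Lemma sorted_restrict d n s : sorted ltn s -> sorted ltn (restrict d n s).
Proof.
move=> ss; rewrite sorted_map.
apply: (sub_in_sorted _ (filter_all _ s) (sorted_filter ltn_trans _ ss)).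
by move=> u v /=; lia.
Qed.

(** Translates restriction to two adjacent intervals into the complementary filters of
    [shuffle_filter] and [shuffle_surj]. As all letters lie in 1, ..., [n + m], the single test
    [v <= n] separates the intervals. *)
Lemma restrict_split n m s a b : all (fun v => 0 < v <= n + m) s ->
  (a == restrict 0 n s) && (b == restrict n m s) =
  (filter (fun v => v <= n) s == a) &&
  (filter (predC (fun v => v <= n)) s == [seq v + n | v <- b]).
Proof.
move=> /allP sP.
have -> : restrict 0 n s = filter (fun v => v <= n) s.
  rewrite /restrict (eq_in_filter (a2 := fun v => v <= n)).
    by rewrite -[RHS]map_id; apply: eq_map => v; rewrite subn0.
  by move=> v /sP /andP[v0 _]; rewrite v0.
have -> : restrict n m s = map (subn^~ n) (filter (predC (fun v => v <= n)) s).
  by rewrite /restrict; congr map; apply: eq_in_filter => v /sP /=; lia.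
rewrite eq_sym; congr andb; apply/eqP/eqP => [->|->].
  rewrite -map_comp -[LHS]map_id; apply/eq_in_map => v.
  by rewrite mem_filter /= => /andP[? _]; lia.
by rewrite -map_comp -[LHS]map_id; apply: eq_map => v /=; lia.
Qed.

End Restriction.

(** * Basis elements as pairs of words, and their restrictions *)

Section Basis.
Implicit Types (x y z p : StarBasis).

Definition deg x : nat := (tag x).+1.
(** The leaves forming singleton tubes; [tail] lists the other leaves in the order in which they
    join the hub. *)
Definition sing x : seq nat := take (rk (tagged x)) (word (tagged x)).
Definition tail x : seq nat := drop (rk (tagged x)) (word (tagged x)).

Lemma size_sing x : size (sing x) = rk (tagged x).
Proof.
have c := codeP (tagged x); rewrite size_takel // (code_size c).
by case/and3P: c.
Qed.

Lemma size_tail x : size (tail x) = (deg x - rk (tagged x))%N.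
Proof. by rewrite size_drop (code_size (codeP (tagged x))). Qed.

Lemma sing_tail x : sing x ++ tail x = word (tagged x).
Proof. exact: cat_take_drop. Qed.

Lemma perm_sing_tail x : perm_eq (sing x ++ tail x) (iota 1 (deg x)).
Proof. by rewrite sing_tail; case/and3P: (codeP (tagged x)). Qed.

Lemma sing_sorted x : sorted ltn (sing x).
Proof. by case/and3P: (codeP (tagged x)). Qed.

Lemma uniq_sing_tail x : uniq (sing x ++ tail x).
Proof. by rewrite (perm_uniq (perm_sing_tail x)) iota_uniq. Qed.

Lemma all_sing_tail x :
  all (fun v => 0 < v <= deg x) (sing x) &&
  all (fun v => 0 < v <= deg x) (tail x).
Proof.
rewrite -all_cat; apply/allP=> v; rewrite (perm_mem (perm_sing_tail x)).
by rewrite mem_iota; lia.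
Qed.

Lemma basis_eq x y : deg x = deg y -> sing x = sing y -> tail x = tail y -> x = y.
Proof.
move=> dxy sxy txy.
have exy : rk (tagged x) = rk (tagged y) by rewrite -!size_sing sxy.
have wxy : word (tagged x) = word (tagged y) by rewrite -!sing_tail sxy txy.
(* Identifying the degrees first gives [T] and [V] the same type, so that [codeK] can compare them
   as sets of tubes. *)
case: x y dxy exy wxy {sxy txy} => [k T] [l V] /= [kl]; subst l => rTV wTV.
by congr existT; apply: val_inj; rewrite -(codeK T) -(codeK V) rTV wTV.
Qed.

(** The code of a tubing is obtained by choice; its uniqueness allows both words to be read off any
    code at hand. *)
Lemma star_elt_code k (T : MT k.+1) r u : is_code k.+1 r u ->
  Tub k.+1 r u = val T ->
  sing (star_elt T) = take r u /\ tail (star_elt T) = drop r u.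
Proof. by move=> cu E; have [-> ->] := code_unique cu E. Qed.

Lemma basis_ex n a b : 0 < n -> perm_eq (a ++ b) (iota 1 n) -> sorted ltn a ->
  exists x, [/\ deg x = n, sing x = a & tail x = b].
Proof.
case: n => // k _ ab sa.
have an : size a <= k.+1.
  by rewrite -(size_iota 1 k.+1) -(perm_size ab) size_cat leq_addr.
have cu : is_code k.+1 (size a) (a ++ b).
  by rewrite /is_code an ab take_size_cat.
pose T : MT k.+1 := exist _ (Tub k.+1 (size a) (a ++ b)) (Tub_maximal cu).
have [sT tT] := @star_elt_code k T _ _ cu erefl.
by exists (star_elt T); rewrite sT tT take_size_cat ?drop_size_cat.
Qed.

Definition part d x z : bool :=
  (sing x == restrict d (deg x) (sing z)) &&
  (tail x == restrict d (deg x) (tail z)).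

(** Restricting keeps [sing z] increasing and leaves each of 1, ..., [n] exactly once in the two
    words, so the result is again a code. *)
Lemma part_ex d n z : 0 < n -> d + n <= deg z ->
  exists2 x, deg x = n & part d x z.
Proof.
move=> n0 dn.
have zn : perm_eq (restrict d n (sing z) ++ restrict d n (tail z)) (iota 1 n).
  rewrite -restrict_cat.
  exact: perm_trans (perm_restrict _ _ (perm_sing_tail z)) (restrict_iota dn).
have [x [dx sx tx]] := basis_ex n0 zn (sorted_restrict _ _ (sing_sorted z)).
by exists x => //; rewrite /part dx sx tx !eqxx.
Qed.

Lemma part_uniq d x y z : deg x = deg y -> part d x z -> part d y z -> x = y.
Proof.
rewrite /part => dxy /andP[/eqP sx /eqP tx] /andP[/eqP sy /eqP ty].
by apply: basis_eq => //; rewrite ?sx ?tx dxy.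
Qed.

Lemma part_part e d x p z : e + deg x <= deg p -> part d p z ->
  part e x p = part (d + e) x z.
Proof.
by move=> ep /andP[/eqP sp /eqP tp]; rewrite /part sp tp !restrict_restrict.
Qed.

(** The condition for [z] to occur in the product of [x] and [y]. *)
Definition shuffles x y z : bool :=
  [&& deg z == deg x + deg y, part 0 x z & part (deg x) y z].

Lemma shufflesE x y z : deg z = deg x + deg y ->
  shuffles x y z =
  ((filter (fun v => v <= deg x) (sing z) == sing x) &&
   (filter (predC (fun v => v <= deg x)) (sing z) ==
    [seq v + deg x | v <- sing y])) &&
  ((filter (fun v => v <= deg x) (tail z) == tail x) &&
   (filter (predC (fun v => v <= deg x)) (tail z) ==
    [seq v + deg x | v <- tail y])).
Proof.
move=> dz; rewrite /shuffles dz eqxx /= /part andbACA.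
by have := all_sing_tail z; rewrite dz => /andP[sz tz]; rewrite !restrict_split.
Qed.

Definition shuffle_elt x y
    (sigma : 'S_(deg x - rk (tagged x) + (deg y - rk (tagged y)))) : StarBasis :=
  star_elt (shuffle_tubing sigma : MT (tag x + (tag y).+1).+1).

(** * The tubings occurring in a product of two basis elements *)

Section ShuffleElt.
Variables x y : StarBasis.
Let N := deg x - rk (tagged x) + (deg y - rk (tagged y)).
Implicit Types sigma : 'S_N.

Lemma sing_tail_shuffle sigma :
  sing (shuffle_elt sigma) = sing x ++ [seq v + deg x | v <- sing y] /\
  tail (shuffle_elt sigma) =
    perm_word 0 (tail x ++ [seq v + deg x | v <- tail y]) sigma.
Proof.
have [-> ->] := star_elt_code
  (T := shuffle_tubing sigma : MT (tag x + (tag y).+1).+1)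
  (shuffle_code sigma) erefl.
have -> : shuffle_word sigma = (sing x ++ [seq v + deg x | v <- sing y]) ++
    perm_word 0 (tail x ++ [seq v + deg x | v <- tail y]) sigma.
  by rewrite -catA.
have sz : size (sing x ++ [seq v + deg x | v <- sing y]) =
    rk (tagged x) + rk (tagged y).
  by rewrite size_cat size_map !size_sing.
by rewrite take_size_cat ?drop_size_cat.
Qed.

Lemma all_low (s : seq nat) : all (fun v => 0 < v <= deg x) s ->
  all (fun v => v <= deg x) s.
Proof. by apply: sub_all => v /andP[]. Qed.

Lemma all_high (s : seq nat) : all (fun v => 0 < v <= deg y) s ->
  all (predC (fun v => v <= deg x)) [seq v + deg x | v <- s].
Proof. by rewrite all_map; apply: sub_all => v /=; lia. Qed.

Let sz1 : size (tail x) = deg x - rk (tagged x) := size_tail x.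
Let sz2 : size [seq v + deg x | v <- tail y] = deg y - rk (tagged y).
Proof. by rewrite size_map size_tail. Qed.
Let low : all (fun v => v <= deg x) (tail x).
Proof. by case/andP: (all_sing_tail x) => _ /all_low. Qed.
Let high : all (predC (fun v => v <= deg x)) [seq v + deg x | v <- tail y].
Proof. by case/andP: (all_sing_tail y) => _ /all_high. Qed.

(** For the tails this is [shuffle_filter]. The singleton words are merely concatenated, the low
    letters before the high ones, so the filters separate them. *)
Lemma shuffle_elt_shuffles sigma :
  sigma \in Sh (deg x - rk (tagged x)) (deg y - rk (tagged y)) ->
  shuffles x y (shuffle_elt sigma).
Proof.
move=> sh; rewrite shufflesE //; have [-> ->] := sing_tail_shuffle sigma.
have [-> ->] := shuffle_filter 0 sz1 sz2 low high sh; rewrite !eqxx !andbT.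
have /andP[/all_low sx _] := all_sing_tail x.
have /andP[/all_high sy _] := all_sing_tail y.
rewrite !filter_cat (all_filterP sx) (all_filterP sy).
set f := filter _ _; have -> : f = [::].
  apply/eqP; rewrite -[_ == _]negbK -has_filter -all_predC.
  exact: sy.
set g := filter _ _; have -> : g = [::].
  apply/eqP; rewrite -[_ == _]negbK -has_filter -all_predC.
  by apply: sub_all sx => v /= ->.
by rewrite cats0 !eqxx.
Qed.

(** The permutation comes from [tail z] by [shuffle_surj]; the word [sing z] is increasing, hence
    determined by its set of letters. *)
Lemma shuffles_ex z : shuffles x y z ->
  exists2 sigma, sigma \in Sh (deg x - rk (tagged x)) (deg y - rk (tagged y))
    & shuffle_elt sigma = z.
Proof.
move=> xyz; have dz : deg z = deg x + deg y by case/and3P: xyz => /eqP.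
rewrite shufflesE // in xyz.
case/andP: xyz => /andP[/eqP sx /eqP sy] /andP[/eqP tx /eqP ty].
have ut : uniq (tail z) by have := uniq_sing_tail z; rewrite cat_uniq => /and3P[].
have [sigma sh wz] := shuffle_surj 0 sz1 sz2 low high ut tx ty.
exists sigma => //; have [ss ts] := sing_tail_shuffle sigma.
apply: basis_eq; rewrite ?dz ?ts //.
apply: (irr_sorted_eq ltn_trans ltnn (sing_sorted _) (sing_sorted _)) => v.
by rewrite ss -sx -sy mem_cat !mem_filter /= -andb_orl orbN.
Qed.

Lemma shuffle_elt_inj : injective (fun sigma => shuffle_elt sigma).
Proof.
move=> s1 s2 e; have [_ t1] := sing_tail_shuffle s1.
have [_ t2] := sing_tail_shuffle s2; rewrite e t2 in t1.
apply/esym/(perm_word_inj _ _ t1); first by rewrite size_cat sz1 sz2.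
rewrite cat_uniq map_inj_uniq; last by move=> u v /addIn.
have := uniq_sing_tail x; have := uniq_sing_tail y; rewrite !cat_uniq.
(* It remains to see that the two tails share no letter: one has letters at most [deg x], the other
   has larger ones. *)
move=> /and3P[_ _ ->] /and3P[_ _ ->]; rewrite andbT /=.
apply/hasPn=> v /(allP high) /=; apply: contra; exact: (allP low).
Qed.

End ShuffleElt.
End Basis.

Local Open Scope ring_scope.

(** * Linear maps on a free module are determined by the basis *)

Section LinearExtension.
Variables (K : fieldType) (B : choiceType) (V : lmodType K).

Lemma linear_malg_sum (F : B -> V) :
  linear (fun f : {malg K[B]} => \sum_(x <- msupp f) f@_x *: F x).
Proof.
(* The three sums run over different supports; all are extended by zero coefficients to the common
   finite set [d]. *)
move=> a f g; pose d := (msupp (a *: f + g) `|` (msupp f `|` msupp g))%fset.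
have ext h : (msupp h `<=` d)%fset ->
    \sum_(x <- msupp h) h@_x *: F x = \sum_(x <- d) h@_x *: F x.
  move=> hd; apply: big_fset_incl => // x _ xh.
  by rewrite mcoeff_outdom // scale0r.
rewrite !ext ?fsubsetUl //; last 2 first.
- by rewrite /d fsetUA fsubsetUr.
- by rewrite /d fsetUA fsetUAC fsubsetUr.
rewrite scaler_sumr -big_split; apply: eq_bigr => x _ /=.
by rewrite mcoeffD mcoeffZ scalerDl scalerA.
Qed.

Lemma linear_malgE (L : {malg K[B]} -> V) : linear L ->
  forall f, L f = \sum_(x <- msupp f) f@_x *: L << x >>.
Proof.
move=> linL f.
pose L' : {linear {malg K[B]} -> V} :=
  HB.pack L (GRing.isLinear.Build _ _ _ _ L linL).
rewrite -[L]/(L' : _ -> _) {1}[f]monalgE linear_sum.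
apply: eq_bigr => x _; rewrite -linearZ; congr (L' _); apply/malgP => k.
by rewrite mcoeffZ !mcoeffU mulrnAr mulr1.
Qed.

Lemma linear_malg_eq (L1 L2 : {malg K[B]} -> V) : linear L1 -> linear L2 ->
  (forall x, L1 << x >> = L2 << x >>) -> L1 =1 L2.
Proof.
move=> lin1 lin2 e f; rewrite (linear_malgE lin1) (linear_malgE lin2).
by apply: eq_bigr => x _; rewrite e.
Qed.

End LinearExtension.

(** * Bilinearity, coefficients of products, and associativity *)

Section Algebra.
Variable K : fieldType.
Implicit Types x y z : StarBasis.

Lemma bilinear_star_mul : bilinear_for *:%R *:%R (@star_mul K).
Proof.
have mulE f g : star_mul f g =
    \sum_(x <- msupp f) f@_x *: \sum_(y <- msupp g) g@_y *: star_mul_basis K x y.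
  apply: eq_bigr => x _; rewrite scaler_sumr.
  by apply: eq_bigr => y _; rewrite scalerA.
split=> [g a f f'|f a g g'] /=; rewrite !mulE; first exact: linear_malg_sum.
rewrite scaler_sumr -big_split; apply: eq_bigr => x _ /=.
rewrite [X in _ *: X]linear_malg_sum scalerDr.
by rewrite !scalerA [a * _]mulrC.
Qed.

(** By [shuffles_ex] and injectivity of [shuffle_elt], exactly one shuffle yields [z] when
    [shuffles x y z] holds, and none otherwise. *)
Lemma mcoeff_star_mul_basis x y z :
  (star_mul_basis K x y)@_z = (shuffles x y z)%:R.
Proof.
rewrite /star_mul_basis raddf_sum /=.
under eq_bigr => sigma _ do rewrite mcoeffU -/(shuffle_elt sigma).
case xyz : (shuffles x y z).
  have [s sh sz] := shuffles_ex xyz.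
  rewrite (bigD1 s) //= sz eqxx big1 ?addr0 // => t /andP[_ ts].
  by rewrite -sz (inj_eq (@shuffle_elt_inj x y)) (negPf ts).
apply: big1 => s /shuffle_elt_shuffles sh.
by case: eqP => // sz; rewrite sz xyz in sh.
Qed.

Lemma mcoeff_star_mulUl x f z :
  (star_mul << x >> f)@_z = \sum_(p <- msupp f) f@_p * (shuffles x p z)%:R :> K.
Proof.
rewrite (linear_malgE (bilinear_star_mul.2 _)) raddf_sum; apply: eq_bigr => p _.
by rewrite /= mcoeffZ star_mulU mcoeff_star_mul_basis.
Qed.

Lemma mcoeff_star_mulUr x f z :
  (star_mul f << x >>)@_z = \sum_(p <- msupp f) f@_p * (shuffles p x z)%:R :> K.
Proof.
rewrite (linear_malgE (bilinear_star_mul.1 _)) raddf_sum; apply: eq_bigr => p _.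
by rewrite /= mcoeffZ star_mulU mcoeff_star_mul_basis.
Qed.

(** The sum counts the [p] satisfying both [A] and [C]. There is at most one, so the count is 0 or 1
    and the characteristic of [K] does not interfere. *)
Lemma sum_mcoeff_bool (B : choiceType) (f : {malg K[B]}) (A C : pred B) (M : bool) :
  (forall p, f@_p = (A p)%:R) ->
  (forall p q, A p && C p -> A q && C q -> p = q) ->
  (M <-> exists p, A p && C p) ->
  \sum_(p <- msupp f) f@_p * (C p)%:R = M%:R.
Proof.
move=> fA uniqAC; case: M => -[M1 M2].
  have [p pAC] := M1 isT; have /andP[pA pC] := pAC.
  rewrite (bigD1_seq p) ?fset_uniq //=; last by rewrite -mcoeff_neq0 fA pA oner_eq0.
  rewrite fA pA pC mulr1 big1 ?addr0 // => q qp.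
  rewrite fA -natrM mulnb; case qAC : (A q && C q) => //.
  by rewrite (uniqAC q p) ?eqxx in qp.
apply: big1 => p _; rewrite fA -natrM mulnb; case pAC : (A p && C p) => //.
by have : false by apply: M2; exists p.
Qed.

Definition shuffles3 x y w z : bool :=
  [&& deg z == (deg x + deg y + deg w)%N, part 0 x z, part (deg x) y z
    & part (deg x + deg y) w z].

Lemma star_mulA_basis x y w :
  star_mul << x >> (star_mul << y >> << w >>) =
  star_mul (star_mul << x >> << y >>) << w >> :> {malg K[StarBasis]}.
Proof.
apply/malgP => z; transitivity ((shuffles3 x y w z)%:R : K).
  rewrite mcoeff_star_mulUl (star_mulU K y w).
  rewrite (@sum_mcoeff_bool _ (star_mul_basis K y w) (shuffles y w)
    (fun p => shuffles x p z) (shuffles3 x y w z)) //.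
  - by move=> p; rewrite mcoeff_star_mul_basis.
  - move=> p q /andP[/and3P[/eqP dp _ _] /and3P[_ _ pz]].
    move=> /andP[/and3P[/eqP dq _ _] /and3P[_ _ qz]].
    by apply: part_uniq pz qz; rewrite dp dq.
  split=> [/and4P[/eqP dz xz yz wz]|[p /andP[]]].
    (* The intermediate tubing is the restriction of [z] to its last [deg y + deg w] leaves. *)
    have [||p dp pz] := @part_ex (deg x) (deg y + deg w) z;
      rewrite ?dz //; try lia.
    exists p; rewrite /shuffles dp dz addnA !eqxx xz pz /= andbT.
    by rewrite !(part_part _ pz) ?dp // ?addn0 ?yz ?wz //; lia.
  move=> /and3P[/eqP dp yp wp] /and3P[/eqP dz xz pz].
  rewrite /shuffles3 dz dp addnA eqxx xz /=.
  by rewrite -[X in part X y]addn0 -!(part_part _ pz) ?dp ?yp ?wp //; lia.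
rewrite mcoeff_star_mulUr (star_mulU K x y).
rewrite (@sum_mcoeff_bool _ (star_mul_basis K x y) (shuffles x y)
  (fun p => shuffles p w z) (shuffles3 x y w z)) //.
- by move=> p; rewrite mcoeff_star_mul_basis.
- move=> p q /andP[/and3P[/eqP dp _ _] /and3P[_ pz _]].
  move=> /andP[/and3P[/eqP dq _ _] /and3P[_ qz _]].
  by apply: part_uniq pz qz; rewrite dp dq.
split=> [/and4P[/eqP dz xz yz wz]|[p /andP[]]].
  (* For the other bracketing, [z] is restricted to its first [deg x + deg y] leaves. *)
  have [||p dp pz] := @part_ex 0 (deg x + deg y) z; rewrite ?dz //; try lia.
  exists p; rewrite /shuffles dp dz !eqxx pz wz /= andbT.
  by rewrite !(part_part _ pz) ?dp ?add0n ?xz ?yz //; lia.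
move=> /and3P[/eqP dp xp yp] /and3P[/eqP dz pz wz].
rewrite /shuffles3 dz dp -dp eqxx wz andbT /=.
rewrite -(@part_part 0 0 x p z) -?(@part_part (deg x) 0 y p z) //.
all: rewrite ?dp ?xp ?yp //; lia.
Qed.

End Algebra.

Theorem proposition6p3 (K : fieldType) :
  bilinear_for *:%R *:%R (@star_mul K) /\ associative (@star_mul K).
Proof.
have [linl linr] := bilinear_star_mul K; split=> // f g h.
(* Both bracketings are linear in each argument, so [f], [g] and [h] are replaced by basis elements
   one after the other. *)
suff /(_ f) : (fun u => star_mul u (star_mul g h)) =1
    (fun u => star_mul (star_mul u g) h) by [].
apply: linear_malg_eq => [||x]; first exact: linl.
  by move=> a u v; rewrite linl linl.
suff /(_ g) : (fun u => star_mul << x >> (star_mul u h)) =1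
    (fun u => star_mul (star_mul << x >> u) h) by [].
apply: linear_malg_eq => [||y].
- by move=> a u v; rewrite linl linr.
- by move=> a u v; rewrite linr linl.
suff /(_ h) :
    (fun u => star_mul << x >> (star_mul << y >> u) : {malg K[StarBasis]}) =1
    star_mul (star_mul << x >> << y >>) by [].
apply: linear_malg_eq => [||w]; last exact: star_mulA_basis.
- by move: << x >> << y >> => f1 f2 a u v; rewrite (linr f2) (linr f1).
- exact: linr.
Qed.
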